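(* Let $S_1,\dots,S_n\in\mathbb R^p$ be deterministic vectors, let $N_1,\dots,N_n$ be independent random vectors with $N_i\sim\mathcal N(0,\Sigma_i)$, and set $I_i=S_i+N_i$. Let $\mathcal T$ be a finite set of $p\times p$ matrices containing $\mathrm I_p$. For $O\in\mathcal T$ set $d^2_{ij,\mathrm{noisy}}(O)=\|I_i-OI_j\|^2$ and $d^2_{ij,\mathrm{clean}}(O)=\|S_i-OS_j\|^2$. Let $t_p:=\sup_i\sup_{O\in\mathcal T}\sqrt{\mathrm{trace}((O\Sigma_iO^T)^2)}$ and $s_p:=\sup_{1\le i\le n}\sup_{O\in\mathcal T}\sqrt{\|O\Sigma_iO^T\|_{op}}$. Then $$\sup_{O\in\mathcal T}\sup_{i\ne j}\big|d^2_{ij,\mathrm{noisy}}(O)-d^2_{ij,\mathrm{clean}}(O)-\mathrm{trace}(\Sigma_i+O\Sigma_jO^T)\big| =O_P\Big(\sqrt{\log[|\mathcal T|n^2]}\big(t_p+s_p\sup_{i,O\in\mathcal T}\|OS_i\|\big)+\log[|\mathcal T|n^2]\,s_p^2\Big).$$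
   Context: All quantities ($n$, $p$, $S_i$, $\Sigma_i$, $\mathcal T$) may depend on the asymptotic index, with $n,p\to\infty$. For random variables $X$ and positive deterministic $a$, $X=O_P(a)$ means: for every $\delta>0$ there is $K$ such that $P(|X|>Ka)<\delta$ for all sufficiently large $n,p$. $|\mathcal T|$ is the cardinality of $\mathcal T$, $\|\cdot\|$ the Euclidean norm, $\|\cdot\|_{op}$ the operator norm. *)

(* Defs.v *)
From HB Require Import structures.
From mathcomp Require Import all_boot all_order all_algebra.
From mathcomp Require Import all_classical all_reals all_analysis.
Set Implicit Arguments. Unset Strict Implicit. Unset Printing Implicit Defensive.
Import Order.TTheory GRing.Theory Num.Theory.
Local Open Scope classical_set_scope.
Local Open Scope ring_scope.

Section defs.
Context {R : realType}.

Definition vdot p (u v : 'cV[R]_p) : R := \sum_(r < p) u r 0 * v r 0.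
Definition sqnorm p (v : 'cV[R]_p) : R := vdot v v.
Definition enorm p (v : 'cV[R]_p) : R := Num.sqrt (sqnorm v).

Definition opnorm p (A : 'M[R]_p) : R :=
  sup [set enorm (A *m v) | v in [set v : 'cV[R]_p | enorm v = 1]].

Definition borel_vec p : set (set 'cV[R]_p) :=
  <<s [set [set v : 'cV[R]_p | forall r, B r (v r 0)] |
         B in [set B : 'I_p -> set R | forall r, measurable (B r)]] >>.

Definition gauss1 (m v : R) : set R -> \bar R :=
  if v == 0 then \d_m else normal_prob m (Num.sqrt v).

Definition random_vec d (Omega : measurableType d) p
    (X : Omega -> 'cV[R]_p) : Prop :=
  forall r : 'I_p, measurable_fun setT (fun w => X w r 0).

Definition gaussian_vec d (Omega : measurableType d) (P : probability Omega R)
    p (X : Omega -> 'cV[R]_p) (Sig : 'M[R]_p) : Prop :=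
  [/\ random_vec X, Sig^T = Sig,
      (forall u : 'cV[R]_p, 0 <= vdot u (Sig *m u)) &
      (forall (u : 'cV[R]_p) (B : set R), measurable B ->
         P [set w | B (vdot u (X w))] = gauss1 0 (vdot u (Sig *m u)) B)].

Definition mutually_independent_vecs d (Omega : measurableType d)
    (P : probability Omega R) n p (X : 'I_n -> Omega -> 'cV[R]_p) : Prop :=
  forall A : 'I_n -> set 'cV[R]_p, (forall i, borel_vec (A i)) ->
    P [set w | forall i, A i (X i w)] =
    (\prod_(i < n) P [set w | A i (X i w)])%E.

(* finite supremum of nonnegative quantities (0 on the empty range) *)
Definition fmax (s : seq R) : R := \big[Num.max/0]_(x <- s) x.

End defs.

(* Main.v *)
Require Import Defs.
From HB Require Import structures.
From mathcomp Require Import all_boot all_order all_algebra.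
From mathcomp Require Import all_classical all_reals all_analysis.
From mathcomp Require Import measurable_realfun complex spectral ring lra.
Import Order.TTheory GRing.Theory Num.Theory.
Local Open Scope classical_set_scope.
Local Open Scope ring_scope.
Set Implicit Arguments. Unset Strict Implicit. Unset Printing Implicit Defensive.

(** For i <> j put X = N_i - O N_j, a = S_i - O S_j and G = Sig_i + O Sig_j O^T.
    The deviation is 2 <a, X> + (|X|^2 - tr G), and by independence X has the
    Gaussian Laplace transform E exp <u, X> = exp (<u, G u> / 2).  This transform
    is all that is used about X: in an eigenbasis of G, with coordinates Y_r and
    eigenvalues g_r,
    - exp (l Y^2 / 2) is a Gaussian mixture of exponentials exp (sqrt l x Y), so
      Tonelli bounds E exp (l |X|^2 / 2);
    - exp (- Y^2 / 2) is dominated by a linear combination of the exponentials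
      exp (k Y), |k| <= 2, whose expectation agrees with that of exp (- Y^2 / 2)
      to first order in g, so expanding the product over r bounds
      E exp (- l |X|^2 / 2).
    Chernoff's bound then gives a tail 4 exp (- 2 L) for each triple (O, i, j)
    at level 48 times the rate, and the union bound over |T| n^2 = exp L triples
    leaves 4 exp (- L), which tends to 0. *)

(** * Orthogonal diagonalisation of real symmetric matrices *)

Section Spectral.
Context {R : realType}.

Lemma vdotE p (u v : 'cV[R]_p) : vdot u v = (u^T *m v) 0 0.
Proof. by rewrite /vdot !mxE; apply: eq_bigr => i _; rewrite mxE. Qed.

(** Seen over the complex numbers, [A] is Hermitian, so its spectral diagonal is real. Being a root
    of the characteristic polynomial then descends along the embedding of the reals. *)
Lemma symmetric_eigenvalue p (A : 'M[R]_p.+1) : A^T = A ->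
  exists l, eigenvalue A l.
Proof.
move=> symA; pose f := real_complex R; pose B := map_mx f A.
have hB : B \is hermsymmx.
  apply: realsym_hermsym.
    apply/is_hermitianmxP; rewrite expr0 scale1r map_mx_id// /B.
    by rewrite map_trmx symA.
  by apply/mxOverP => i j; rewrite mxE; apply/CrealP; rewrite /= /f; exact: conjc_real.
have dR := hermitian_spectral_diag_real hB.
have /orthomx_spectralP BE := hermitian_normalmx hB.
set d := spectral_diag B in dR BE.
have PB : spectralmx B *m B = diag_mx d *m spectralmx B.
  by rewrite [X in _ *m X]BE !mulmxA mulmxV ?spectral_unit// mul1mx.
have /mxOverP/(_ 0 0) d0R := dR.
have [l dl] : exists l : R, d 0 0 = f l.
  exists (complex.Re (d 0 0)); move/CrealP: d0R.
  by case: (d 0 0) => a b [] /eqP; rewrite /f /= => h; congr Complex; lra.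
exists l; rewrite eigenvalue_root_char -(fmorph_root f) map_char_poly.
rewrite -/B -eigenvalue_root_char (_ : GRing.RMorphism.sort _ l = d 0 0)//.
(* Row 0 of [PB] makes this row a left eigenvector; it is nonzero because the spectral matrix is
   unitary. *)
apply/eigenvalueP; exists (row 0 (spectralmx B)).
  by rewrite -row_mul PB row_mul row_diag_mx -scalemxAl -rowE.
apply/eqP => r0; have /unitarymxP := spectral_unitarymx B.
move/(congr1 (row 0)); rewrite row_mul r0 mul0mx => /rowP/(_ 0).
by rewrite !mxE eqxx => /eqP; rewrite eq_sym oner_eq0.
Qed.

Lemma vdotC p (u v : 'cV[R]_p) : vdot u v = vdot v u.
Proof. by apply: eq_bigr => i _; rewrite mulrC. Qed.

Lemma vdotDl p (u v w : 'cV[R]_p) : vdot (u + v) w = vdot u w + vdot v w.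
Proof. by rewrite -big_split; apply: eq_bigr => i _; rewrite mxE mulrDl. Qed.

Lemma vdotZl p a (u v : 'cV[R]_p) : vdot (a *: u) v = a * vdot u v.
Proof. by rewrite mulr_sumr; apply: eq_bigr => i _; rewrite mxE mulrA. Qed.

Lemma vdotDr p (u v w : 'cV[R]_p) : vdot w (u + v) = vdot w u + vdot w v.
Proof. by rewrite !(vdotC w) vdotDl. Qed.

Lemma vdotZr p a (u v : 'cV[R]_p) : vdot v (a *: u) = a * vdot v u.
Proof. by rewrite !(vdotC v) vdotZl. Qed.

Lemma vdotNr p (u v : 'cV[R]_p) : vdot v (- u) = - vdot v u.
Proof. by rewrite -scaleN1r vdotZr mulN1r. Qed.

Lemma vdotNl p (u v : 'cV[R]_p) : vdot (- u) v = - vdot u v.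
Proof. by rewrite vdotC vdotNr vdotC. Qed.

Lemma vdot_mull m p (A : 'M[R]_(p, m)) u v : vdot (A *m u) v = vdot u (A^T *m v).
Proof. by rewrite !vdotE trmx_mul mulmxA. Qed.

Lemma sqnorm_ge0 p (v : 'cV[R]_p) : 0 <= sqnorm v.
Proof. by apply: sumr_ge0 => i _; rewrite -expr2 sqr_ge0. Qed.

Lemma sqnorm_eq0 p (v : 'cV[R]_p) : (sqnorm v == 0) = (v == 0).
Proof.
apply/idP/eqP => [|->]; last by rewrite /sqnorm /vdot big1// => i _; rewrite mxE mul0r.
rewrite psumr_eq0 => [/allP h|i _]; last by rewrite -expr2 sqr_ge0.
apply/colP => i; rewrite mxE; apply/eqP.
by have := h i (mem_index_enum _); rewrite mulf_eq0 orbb.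
Qed.

(** The reflection along [v - e] exchanges the unit vectors [e] and [v]. It extends a unit
    eigenvector to an orthonormal basis. *)
Lemma householder p (v : 'cV[R]_p.+1) : sqnorm v = 1 ->
  exists2 H : 'M[R]_p.+1, H^T *m H = 1%:M & H *m delta_mx 0 0 = v.
Proof.
set e : 'cV[R]_p.+1 := delta_mx 0 0 => v1.
have [->|ve] := eqVneq v e.
  by exists 1%:M; rewrite ?trmx1 mul1mx.
have e1 : sqnorm e = 1.
  rewrite /sqnorm /vdot (bigD1 ord0)//= big1 => [|i i0]; rewrite !mxE ?eqxx.
    by rewrite mulr1 addr0.
  by rewrite (negbTE i0) mul0r.
pose w := v - e; pose c := sqnorm w.
have c0 : c != 0 by rewrite sqnorm_eq0 subr_eq0.
(* Both vectors are unit, so [c = 2 - 2 <v, e>]; hence the reflection sends [e] to [e + w = v]. *)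
have we : vdot w e = - (c / 2).
  rewrite /c /w /sqnorm !vdotDl !vdotDr !vdotNr !vdotNl (vdotC e v).
  by rewrite -!/(sqnorm _) v1 e1; field.
have wwT : w^T *m w = c%:M.
  by rewrite [LHS]mx11_scalar -vdotE.
pose W := w *m w^T.
have WW : W *m W = c *: W.
  by rewrite /W mulmxA -(mulmxA w) wwT mul_mx_scalar -scalemxAl.
pose H := 1%:M - (2 / c) *: W.
have HT : H^T = H by rewrite /H linearB linearZ/= trmx1 trmx_mul trmxK.
exists H.
  rewrite HT /H mulmxBl !mulmxBr !mul1mx !mulmx1 -scalemxAl -scalemxAr WW.
  by apply/matrixP => i j; rewrite !mxE; field.
rewrite mulmxBl mul1mx -scalemxAl -mulmxA.
rewrite (_ : w^T *m e = (- (c / 2))%:M); last by rewrite [LHS]mx11_scalar -vdotE we.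
rewrite mul_mx_scalar scalerA (_ : _ * _ = -1); last by field.
by rewrite scaleN1r opprK addrC subrK.
Qed.

(** Induction on the dimension: a reflection carries the first basis vector to a unit eigenvector,
    so the conjugated matrix splits into a scalar block and a symmetric block of size [p]. *)
Theorem spectral p (A : 'M[R]_p) : A^T = A ->
  exists U : 'M[R]_p, exists d : 'rV[R]_p,
    U^T *m U = 1%:M /\ U^T *m A *m U = diag_mx d.
Proof.
elim: p A => [|p IH] A symA.
  by exists 1%:M, 0; split; [rewrite mulmx1 trmx1|apply/matrixP; case].
have [l /eigenvalueP [v vA v0]] := symmetric_eigenvalue symA.
pose x := (enorm v^T)^-1 *: v^T.
have vp : 0 < sqnorm v^T.
  by rewrite lt0r sqnorm_ge0 andbT sqnorm_eq0 trmx_eq0.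
have x1 : sqnorm x = 1.
  rewrite /sqnorm vdotZl vdotZr mulrA -/(sqnorm _) -[X in _ * X]sqr_sqrtr ?ltW//.
  by rewrite -/(enorm _) expr2 mulrACA mulVf ?mul1r// gt_eqF// sqrtr_gt0.
have Ax : A *m x = l *: x.
  by rewrite -scalemxAr -{1}symA -trmx_mul vA linearZ/= !scalerA mulrC.
have [H HH He] := householder x1.
pose B := H^T *m A *m H.
have symB : B^T = B by rewrite /B !trmx_mul trmxK symA mulmxA.
have Be : B *m delta_mx 0 0 = l *: delta_mx 0 0 :> 'cV_p.+1.
  by rewrite /B -!mulmxA He Ax -scalemxAr -He mulmxA HH mul1mx.
have Bi0 i : B i 0 = l *+ (i == 0).
  move/colP : Be => /(_ i); rewrite -colE !mxE => ->.
  by rewrite eqxx andbT mulr_natr.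
have BB : H^T *m A *m H = B by [].
clearbody B.
(* [C] is [B] typed with dimension [1 + p], which gives access to block decompositions. *)
pose C : 'M[R]_(1 + p) := B.
have symC : C^T = C by exact: symB.
pose o : 'I_p.+1 := lshift p (0 : 'I_1).
have l0 : o = ord0 by exact: val_inj.
pose r (i : 'I_p) : 'I_p.+1 := rshift 1 i.
(* The first column comes from the eigenvector, the first row from symmetry. *)
have CE : C = block_mx l%:M 0 0 (drsubmx C).
  rewrite -[LHS]submxK; congr block_mx; apply/matrixP => i j.
  - by rewrite !ord1 !mxE -[LHS]/(B o o) l0 Bi0.
  - by rewrite ord1 -symC !mxE -[LHS]/(B (r j) o) l0 Bi0.
  - by rewrite ord1 !mxE -[LHS]/(B (r i) o) l0 Bi0.
have [U' [d' [UU dE]]] := IH (drsubmx C) (etrans (trmx_drsub C) (congr1 _ symC)).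
pose G : 'M[R]_(1 + p) := block_mx 1%:M 0 0 U'.
pose G1 : 'M[R]_p.+1 := G.
have GT : G^T = block_mx 1%:M 0 0 U'^T by rewrite tr_block_mx trmx1 !trmx0.
exists (H *m G1), (row_mx l%:M d'); rewrite trmx_mul; split.
  rewrite mulmxA -(mulmxA _ H^T) HH mulmx1.
  change (G^T *m G = 1%:M); rewrite GT mulmx_block !mul0mx !mulmx0 mul1mx.
  by rewrite !addr0 !add0r UU -scalar_mx_block.
have -> : G1^T *m H^T *m A *m (H *m G1) = G^T *m C *m G :> 'M[R]_p.+1.
  by rewrite /C -BB !mulmxA.
rewrite CE GT !mulmx_block !mul0mx !mulmx0 !mul1mx !mulmx1 !addr0 !add0r dE.
rewrite mul0mx -[RHS]/(diag_mx (row_mx (l%:M : 'rV_1) d')) diag_mx_row.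
suff -> : diag_mx (l%:M : 'rV_1) = l%:M by [].
by apply/matrixP => i j; rewrite !ord1 !mxE.
Qed.

(** * Trace, operator norm and Euclidean norm inequalities *)

Lemma mxtrace_sqr p (A : 'M[R]_p) (d : 'rV[R]_p) (U : 'M[R]_p) :
  U^T *m U = 1%:M -> U^T *m A *m U = diag_mx d ->
  \tr A = \sum_i d 0 i /\ \tr (A *m A) = \sum_i d 0 i ^+ 2.
Proof.
move=> UU dE; have UU' := mulmx1C UU.
have trE B : \tr B = \tr (U^T *m B *m U).
  by rewrite mxtrace_mulC mulmxA UU' mul1mx.
rewrite (trE A) (trE (A *m A)) dE mxtrace_diag; split=> //.
have -> : U^T *m (A *m A) *m U = diag_mx d *m diag_mx d.
  by rewrite -dE !mulmxA -(mulmxA _ U) UU' mulmx1.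
by rewrite mulmx_diag mxtrace_diag; apply: eq_bigr => i _; rewrite mxE.
Qed.

Lemma vdot_spectral p (A : 'M[R]_p) (d : 'rV[R]_p) (U : 'M[R]_p) (u : 'cV[R]_p) :
  U^T *m A *m U = diag_mx d ->
  vdot (U *m u) (A *m (U *m u)) = \sum_i d 0 i * u i 0 ^+ 2.
Proof.
move=> dE; rewrite vdot_mull !mulmxA dE; apply: eq_bigr => i _.
by rewrite mul_diag_mx !mxE mulrCA expr2.
Qed.

Lemma sqnorm_orth p (U : 'M[R]_p) (v : 'cV[R]_p) :
  U^T *m U = 1%:M -> sqnorm (U *m v) = sqnorm v.
Proof. by move=> UU; rewrite /sqnorm vdot_mull mulmxA UU mul1mx. Qed.

(** Cauchy-Schwarz: expand the squared norm of [|v|^2 u - <u, v> v] and divide by [|v|^2]. *)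
Lemma vdot_sqr_le p (u v : 'cV[R]_p) : vdot u v ^+ 2 <= sqnorm u * sqnorm v.
Proof.
have [->|v0] := eqVneq v 0.
  by rewrite -[X in vdot _ X](scale0r (0 : 'cV_p)) vdotZr mul0r expr0n mulr_ge0// sqnorm_ge0.
have vp : 0 < sqnorm v by rewrite lt0r sqnorm_ge0 sqnorm_eq0 v0.
have := sqnorm_ge0 (sqnorm v *: u - vdot u v *: v).
rewrite /sqnorm !(vdotDl, vdotDr, vdotNl, vdotNr, vdotZl, vdotZr) (vdotC v u).
rewrite -!/(sqnorm _) => h.
rewrite -(ler_pM2l vp) -subr_ge0; apply: le_trans h _; lra.
Qed.

Lemma enorm_ge0 p (v : 'cV[R]_p) : 0 <= enorm v.
Proof. exact: sqrtr_ge0. Qed.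

Lemma enorm_sqr p (v : 'cV[R]_p) : enorm v ^+ 2 = sqnorm v.
Proof. by rewrite sqr_sqrtr// sqnorm_ge0. Qed.

(** Cauchy-Schwarz row by row. This Frobenius bound shows that the set defining [opnorm] is bounded
    above, so that its [sup] is a true supremum. *)
Lemma enorm_mulmx_ub p (A : 'M[R]_p) (v : 'cV[R]_p) :
  enorm (A *m v) <= Num.sqrt (\sum_i sqnorm (row i A)^T) * enorm v.
Proof.
rewrite -sqrtrM ?sumr_ge0// => [|i _]; last exact: sqnorm_ge0.
rewrite ler_wsqrtr// mulr_suml; apply: ler_sum => i _.
apply: le_trans (vdot_sqr_le _ _); rewrite -expr2 le_eqVlt; apply/orP; left.
apply/eqP; congr (_ ^+ 2); rewrite mxE; apply: eq_bigr => j _; by rewrite !mxE.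
Qed.

Lemma enorm_le_opnorm p (A : 'M[R]_p) (v : 'cV[R]_p) :
  enorm v = 1 -> enorm (A *m v) <= opnorm A.
Proof.
move=> v1; apply: ub_le_sup; last by exists v.
exists (Num.sqrt (\sum_i sqnorm (row i A)^T)) => _ [u /= u1 <-].
by apply: le_trans (enorm_mulmx_ub _ _) _; rewrite u1 mulr1.
Qed.

(** Cauchy-Schwarz settles unit vectors and homogeneity the others. The case [v = 0] stands apart
    and covers dimension 0, where there is no unit vector. *)
Lemma vdot_le_opnorm p (A : 'M[R]_p) (v : 'cV[R]_p) :
  vdot v (A *m v) <= opnorm A * sqnorm v.
Proof.
have unit (u : 'cV_p) : enorm u = 1 -> vdot u (A *m u) <= opnorm A.
  move=> u1; apply: le_trans (enorm_le_opnorm A u1).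
  apply: le_trans (ler_norm _) _; rewrite -(ler_pXn2r (ltn0Sn 1)) ?nnegrE ?enorm_ge0//.
  rewrite real_normK ?num_real// enorm_sqr -[leRHS]mul1r -[X in X * _](expr1n _ 2).
  by rewrite -u1 enorm_sqr vdot_sqr_le.
have [->|v0] := eqVneq v 0.
  by rewrite mulmx0 /sqnorm -[X in vdot X _](scale0r (0 : 'cV_p)) !vdotZl !mul0r mulr0.
have vp : 0 < sqnorm v by rewrite lt0r sqnorm_ge0 sqnorm_eq0 v0.
have ep : 0 < enorm v by rewrite sqrtr_gt0.
have := unit ((enorm v)^-1 *: v).
rewrite -scalemxAr vdotZl vdotZr mulrA -expr2 exprVn enorm_sqr mulrC ler_pdivrMr//; apply.
rewrite /enorm /sqnorm vdotZl vdotZr mulrA -expr2 exprVn enorm_sqr mulVf ?sqrtr1//.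
by rewrite gt_eqF.
Qed.

(** Parallelogram law: the gap is [sqnorm (u + v)]. *)
Lemma sqnormB_le p (u v : 'cV[R]_p) : sqnorm (u - v) <= 2 * sqnorm u + 2 * sqnorm v.
Proof.
rewrite -subr_ge0; apply: le_trans (sqnorm_ge0 (u + v)) _.
by rewrite /sqnorm !(vdotDl, vdotDr, vdotNl, vdotNr) (vdotC v u); lra.
Qed.

(** The gap is the trace of [(A - B)^2], a sum of squares because [A - B] is symmetric. *)
Lemma mxtrace_sqrD_le p (A B : 'M[R]_p) : A^T = A -> B^T = B ->
  \tr ((A + B) *m (A + B)) <= 2 * \tr (A *m A) + 2 * \tr (B *m B).
Proof.
move=> sA sB; have sub_ge0 : 0 <= \tr ((A - B) *m (A - B)).
  apply: sumr_ge0 => i _; rewrite mxE; apply: sumr_ge0 => j _.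
  have sAB : (A - B)^T = A - B by rewrite linearB/= sA sB.
  by rewrite -{2}sAB [X in _ * X]mxE -expr2 sqr_ge0.
rewrite -subr_ge0; apply: le_trans sub_ge0 _.
rewrite !(mulmxDl, mulmxDr, mulNmx, mulmxN) !(mxtraceD, raddfN, raddfB)/=.
by rewrite (mxtrace_mulC B A); lra.
Qed.

(** * Finite maxima with default value 0 *)

Lemma le_fmax (s : seq R) x : x \in s -> x <= fmax s.
Proof.
rewrite /fmax; elim: s => // y s IH; rewrite inE big_cons le_max => /orP[/eqP->|/IH->].
  by rewrite lexx.
by rewrite orbT.
Qed.

Lemma fmax_ge0 (s : seq R) : 0 <= fmax s.
Proof. by rewrite /fmax; elim: s => [|y s IH]; rewrite ?big_nil// big_cons le_max IH orbT. Qed.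

(** Turns exceedance by a maximum into a union of events; [0 <= c] rules out exceedance by the
    default value 0. *)
Lemma lt_fmax (s : seq R) c : 0 <= c ->
  (c < fmax s) = has (fun x => c < x) s.
Proof.
move=> c0; rewrite /fmax; elim: s => [|y s IH].
  by rewrite big_nil ltNge c0.
by rewrite big_cons lt_max IH.
Qed.

End Spectral.

(** * Exponential integrals against one-dimensional normal laws *)

Section Normal.
Context {R : realType}.
Notation mu := (@lebesgue_measure R).

(** The Radon-Nikodym derivative of [normal_prob] and [normal_pdf] have the same integral over every
    measurable set, so they agree almost everywhere. *)
Lemma ge0_integral_normal_prob (m s : R) (f : R -> \bar R) :
  measurable_fun setT f -> (forall x, 0 <= f x)%E ->
  (\int[normal_prob m s]_x f x = \int[mu]_x (f x * (normal_pdf m s x)%:E))%E.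
Proof.
move=> mf f0; have dom := normal_prob_dominates m s.
rewrite -(Radon_Nikodym_SigmaFinite.change_of_variables dom)//.
have fin := Radon_Nikodym_SigmaFinite.f_integrable dom.
apply: ae_eq_integral => //.
- by apply: emeasurable_funM => //; exact: measurable_int fin.
- by apply: emeasurable_funM => //; apply/measurable_EFinP; exact: measurable_normal_pdf.
- apply: ae_eqe_mul2l; apply: integral_ae_eq => //.
  + by apply/measurable_EFinP; exact: measurable_normal_pdf.
  + by move=> E _ mE; rewrite -Radon_Nikodym_SigmaFinite.f_integral.
Qed.

(** Completing the square: the tilted density is a constant times the normal density of mean
    [t * s ^+ 2]. *)
Lemma integral_expR_normal_pdf (s t : R) : s != 0 ->
  (\int[mu]_x ((expR (t * x))%:E * (normal_pdf 0 s x)%:E) =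
   (expR (t ^+ 2 * s ^+ 2 / 2))%:E)%E.
Proof.
move=> s0.
under eq_integral.
  move=> x _; rewrite -EFinM (_ : expR (t * x) * normal_pdf 0 s x = expR (t ^+ 2 * s ^+ 2 / 2) *
    normal_pdf (t * s ^+ 2) s x).
    rewrite EFinM; over.
  rewrite !normal_pdfE//= /normal_fun. rewrite mulrCA [RHS]mulrCA; congr (_ * _).
  by rewrite -!expRD; congr expR; field.
rewrite integralZl//; last exact: integrable_normal_pdf.
by rewrite integral_normal_pdf mule1.
Qed.

(** The integrand is [s] times the centred normal density of variance [s ^+ 2 = (1 - t)^-1]. *)
Lemma integral_expR_sqr_normal_pdf (t : R) : t < 1 ->
  (\int[mu]_x ((expR (t * x ^+ 2 / 2))%:E * (normal_pdf 0 1 x)%:E) =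
   ((Num.sqrt (1 - t))^-1)%:E)%E.
Proof.
move=> t1; have t0 : 0 < 1 - t by rewrite subr_gt0.
pose s := (Num.sqrt (1 - t))^-1.
have s0 : s != 0 by rewrite invr_eq0 gt_eqF// sqrtr_gt0.
have s2 : s ^+ 2 = (1 - t)^-1 by rewrite exprVn sqr_sqrtr// ltW.
have sp : 0 <= s by rewrite invr_ge0 sqrtr_ge0.
under eq_integral.
  move=> x _; rewrite -EFinM (_ : expR (t * x ^+ 2 / 2) * normal_pdf 0 1 x = s * normal_pdf 0 s x).
    rewrite EFinM; over.
  rewrite !normal_pdfE ?oner_eq0//= mulrCA [RHS]mulrA; congr (_ * _).
    rewrite /normal_peak expr1n -!mulrnAr mul1r sqrtrM ?sqr_ge0// sqrtr_sqr ger0_norm//.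
    by rewrite invfM mulrA divff// mul1r.
  rewrite /normal_fun -!expRD; congr expR; rewrite s2 !subr0; field.
  by rewrite gt_eqF.
rewrite integralZl//; last exact: integrable_normal_pdf.
by rewrite integral_normal_pdf mule1.
Qed.

End Normal.

(** * Laplace transforms of Gaussian vectors, and independence *)

Section Gaussian.
Context {R : realType} d (Omega : measurableType d) (P : probability Omega R).

Lemma measurable_vdot p (u : 'cV[R]_p) (X : Omega -> 'cV[R]_p) :
  random_vec X -> measurable_fun setT (fun w => vdot u (X w)).
Proof.
move=> mX; apply: measurable_sum => i; apply: measurable_funM => //.
Qed.

(** The integral is moved to the law of [vdot u X]: a Dirac mass at 0 when the variance vanishes, a
    normal law otherwise. *)
Lemma gaussian_mgf p (X : Omega -> 'cV[R]_p) (Sig : 'M[R]_p) (u : 'cV[R]_p) :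
  gaussian_vec P X Sig ->
  (\int[P]_w (expR (vdot u (X w)))%:E = (expR (vdot u (Sig *m u) / 2))%:E)%E.
Proof.
move=> [mX _ pSig law]; set v := vdot u (Sig *m u).
pose f w : measurableTypeR R := vdot u (X w).
have mf : measurable_fun setT f by exact: measurable_vdot.
pose F : {mfun Omega >-> measurableTypeR R} := HB.pack f (isMeasurableFun.Build _ _ _ _ f mf).
have mexp : measurable_fun setT (fun x : measurableTypeR R => (expR x)%:E).
  exact/measurable_EFinP.
rewrite -[LHS](@ge0_integral_distribution _ _ _ _ _ P F
  (fun x : measurableTypeR R => (expR x)%:E))//.
have lawF B : measurable B -> distribution P F B = gauss1 0 v B by exact: law.
have [v0|v0] := eqVneq v 0.
  transitivity (\int[\d_((0%R : R) : measurableTypeR R)]_x (expR x)%:E)%E.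
    by apply: eq_measure_integral => B mB _; rewrite [LHS]lawF// /gauss1 v0 eqxx.
  by rewrite integral_dirac// diracT mul1e v0 mul0r.
have vp : 0 < v by rewrite lt0r v0 pSig.
transitivity (\int[normal_prob 0 (Num.sqrt v)]_x (expR x)%:E)%E.
  by apply: eq_measure_integral => B mB _; rewrite [LHS]lawF// /gauss1 (negbTE v0).
rewrite ge0_integral_normal_prob//.
have := @integral_expR_normal_pdf R (Num.sqrt v) 1.
rewrite expr1n mul1r sqr_sqrtr ?ltW// => <-; last by rewrite gt_eqF// sqrtr_gt0.
by apply: eq_integral => x _; rewrite mul1r.
Qed.

Lemma borel_vec_vdot p (u : 'cV[R]_p) (B : set R) : measurable B ->
  borel_vec [set x : 'cV[R]_p | B (vdot u x)].
Proof.
move=> mB; pose V : pointedType := HB.pack 'cV[R]_p (isPointed.Build 'cV[R]_p 0).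
pose G : set (set V) := [set [set v : 'cV[R]_p | forall r, B r (v r 0)] |
         B in [set B : 'I_p -> set R | forall r, measurable (B r)]].
have mr r : measurable_fun setT (fun x : g_sigma_algebraType G => (x : 'cV[R]_p) r 0).
  move=> _ C mC; rewrite setTI; apply: sub_sigma_algebra.
  (* The box with side [C] in direction [r] and the whole line in the others. *)
  exists (fun s => if s == r then C else setT) => [s|]; first by case: ifP.
  apply/seteqP; split=> x /=.
    by move/(_ r); rewrite eqxx.
  by move=> Cx s; case: eqP => // ->.
have mu : measurable_fun setT (fun x : g_sigma_algebraType G => vdot u (x : 'cV[R]_p)).
  by apply: measurable_sum => i; apply: measurable_funM => //.
by have := mu measurableT B mB; rewrite setTI.
Qed.

(** By uniqueness of the product measure, the joint law of the two scalars is the product of their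
    laws; Tonelli then factors the exponential. *)
Lemma indep_mgf n p (X : 'I_n -> Omega -> 'cV[R]_p) (i j : 'I_n) (u v : 'cV[R]_p) :
  (forall i, random_vec (X i)) -> mutually_independent_vecs P X -> i != j ->
  (\int[P]_w (expR (vdot u (X i w) + vdot v (X j w)))%:E =
   \int[P]_w (expR (vdot u (X i w)))%:E * \int[P]_w (expR (vdot v (X j w)))%:E)%E.
Proof.
move=> mX indX ij.
pose f w := vdot u (X i w); pose g w := vdot v (X j w).
have mf : measurable_fun setT f by exact: measurable_vdot.
have mg : measurable_fun setT g by exact: measurable_vdot.
have mh : measurable_fun setT (fun w => (f w, g w)) by exact/measurable_fun_pair.
pose F : {mfun Omega >-> R} := HB.pack f (isMeasurableFun.Build _ _ _ _ f mf).
pose G : {mfun Omega >-> R} := HB.pack g (isMeasurableFun.Build _ _ _ _ g mg).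
pose H : {mfun Omega >-> (R * R)%type} := HB.pack (fun w => (f w, g w))
  (isMeasurableFun.Build _ _ _ _ (fun w => (f w, g w)) mh).
have ind A B : measurable A -> measurable B ->
    (distribution P H (A `*` B) = distribution P F A * distribution P G B)%E.
  move=> mA mB.
  (* The indices other than [i] and [j] get the whole space and contribute a factor 1. *)
  pose E l : set 'cV[R]_p := if l == i then [set x | A (vdot u x)]
    else if l == j then [set x | B (vdot v x)] else setT.
  have bE l : borel_vec (E l).
    rewrite /E; case: ifP => _; first exact: borel_vec_vdot.
    case: ifP => _; first exact: borel_vec_vdot.
    by rewrite -setC0 -setTD; apply: sigma_algebraCD; exact: sigma_algebra0.
  have := indX E bE.
  rewrite (bigD1 i)// (bigD1 j) 1?eq_sym//= big1 => [|l /andP[li lj]]; last first.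
    by rewrite /E (negbTE li) (negbTE lj) -[RHS](probability_setT P); congr (P _); apply/seteqP.
  rewrite mule1 /E eqxx eq_sym (negbTE ij) eqxx => <-.
  congr (P _); apply/seteqP; split=> w /=.
    by move=> [Aw Bw] l; case: eqP => [->//|_]; case: eqP => [->|].
  move=> h; split; first by have := h i; rewrite eqxx.
  by have := h j; rewrite eq_sym (negbTE ij) eqxx.
have m2 : measurable_fun setT (fun z : R * R => (expR (z.1 + z.2))%:E).
  apply/measurable_EFinP; apply: measurableT_comp => //.
  by apply: measurable_funD; [exact: measurable_fst|exact: measurable_snd].
rewrite -[LHS](@ge0_integral_distribution _ _ _ _ _ P H (fun z => (expR (z.1 + z.2))%:E))//.
transitivity (\int[(distribution P F \x distribution P G)%E]_z (expR (z.1 + z.2))%:E)%E.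
  apply: eq_measure_integral => A mA _.
  by rewrite -(@product_measure_unique _ _ _ _ _
    (distribution P F) (distribution P G) (distribution P H)).
rewrite fubini_tonelli1//.
have mexp : measurable_fun setT (fun x : R => (expR x)%:E).
  exact/measurable_EFinP.
rewrite /fubini_F/=.
under eq_integral.
  move=> x _.
  under eq_integral do rewrite expRD EFinM.
  rewrite ge0_integralZl//.
  over.
rewrite ge0_integralZr//; last first.
  by apply: integral_ge0 => y _; rewrite lee_fin expR_ge0.
by rewrite !ge0_integral_distribution.
Qed.

End Gaussian.

(** * Elementary inequalities for the exponential *)

Section RealInequalities.
Import numFieldNormedType.Exports.
Context {R : realType}.
Implicit Types x t : R.

(** The expression is [2 exp x (x cosh x - sinh x)]. It vanishes at 0, and its derivative is
    nonnegative because [exp (- 2 y) >= 1 - 2 y]. *)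
Lemma expR_mul2_cosh_ge0 x : 0 <= x -> 0 <= expR (2 * x) * (x - 1) + (x + 1).
Proof.
move=> x0; pose F (y : R^o) : R^o := expR (2 * y) * (y - 1) + (y + 1).
have dF (y : R^o) : is_derive y (1 : R^o) F (expR (2 * y) * (2 * y - 1) + 1).
  by apply: is_derive_eq; rewrite /GRing.scale /=; ring.
have -> : 0 = F 0 by rewrite /F mulr0 expR0; ring.
apply: (@ger0_derive1_ndecry R F 0) => //.
- move=> y; rewrite in_itv/= andbT => y0; rewrite derive1E derive_val.
  have : 1 - 2 * y <= expR (- (2 * y)) by rewrite expR_ge1Dx.
  rewrite -(ler_pM2l (expR_gt0 (2 * y))) expRxMexpNx_1; lra.
apply: continuous_subspaceT => y; apply: differentiable_continuous.
exact/derivable1_diffP.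
Qed.

(** By evenness take [x >= 0]; there [exp (- y^2 / 2) (exp y + exp (- y))] is nonincreasing by the
    preceding inequality, and equals 2 at 0. *)
Lemma cosh_le_expR_sqr x : expR x + expR (- x) <= 2 * expR (x ^+ 2 / 2).
Proof.
wlog x0 : x / 0 <= x => [h|].
  have [/h//|x0] := leP 0 x.
  by have := h (- x); rewrite opprK sqrrN addrC; apply; rewrite oppr_ge0 ltW.
pose D (y : R^o) : R^o := expR (- (y ^+ 2 / 2)) * (expR y + expR (- y)).
have dD (y : R^o) : is_derive y (1 : R^o) D (- (expR (- (y ^+ 2 / 2)) * expR (- y) *
     (expR (2 * y) * (y - 1) + (y + 1)))).
  apply: is_derive_eq; rewrite /GRing.scale /=.
  have -> : 2 * y = y + y by ring.
  have h : expR (- y) * expR y = 1 by rewrite mulrC expRxMexpNx_1.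
  rewrite expRD mulr0 -[X in _ = - X]mulrA [X in _ = - (_ * X)]mulrDr.
  by rewrite !(mulrA (expR (- y))) h mul1r; field.
suff : D x <= 2 by rewrite /D (expRN (x ^+ 2 / 2)) mulrC ler_pdivrMr ?expR_gt0.
have -> : 2 = D 0 by rewrite /D expr0n mul0r oppr0 expR0; ring.
apply: (@ler0_derive1_nincry R D 0) => //.
- move=> y; rewrite in_itv/= andbT => y0; rewrite derive1E derive_val.
  by rewrite oppr_le0 !mulr_ge0 ?expR_ge0// expR_mul2_cosh_ge0// ltW.
- apply: continuous_subspaceT => y; apply: differentiable_continuous.
  exact/derivable1_diffP.
Qed.

(* [z = cosh x - 1]; [1 / (1 + z) <= 1 - z + z ^ 2] since [(1 + z) (1 - z + z ^ 2) = 1 + z ^ 3] *)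
Lemma expRN_sqr_le x :
  expR (- (x ^+ 2 / 2)) <= 7 / 2 - 3 / 2 * (expR x + expR (- x))
    + 1 / 4 * (expR (2 * x) + expR (- (2 * x))).
Proof.
pose z := (expR x + expR (- x)) / 2 - 1.
have h : expR x * expR (- x) = 1 by rewrite expRxMexpNx_1.
have z0 : 0 <= z.
  have := sqr_ge0 (expR x - 1); have := expR_gt0 (- x); rewrite /z; nra.
have -> : 7 / 2 - 3 / 2 * (expR x + expR (- x)) +
    1 / 4 * (expR (2 * x) + expR (- (2 * x))) = 1 - z + z ^+ 2.
  have -> : 2 * x = x + x by ring.
  by rewrite opprD !expRD /z; field: h.
have zx : 1 + z <= expR (x ^+ 2 / 2).
  by have := cosh_le_expR_sqr x; rewrite /z; lra.
rewrite expRN -[leLHS]mul1r ler_pdivrMr ?expR_gt0//.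
apply: (@le_trans _ _ ((1 - z + z ^+ 2) * (1 + z))).
  have -> : (1 - z + z ^+ 2) * (1 + z) = 1 + z ^+ 3 by ring.
  by rewrite lerDl exprn_ge0.
by apply: ler_wpM2l => //; nra.
Qed.

(** After squaring, [exp y >= 1 + y] reduces the claim to [(1 - t) (1 + t + 2 t^2) = 1 + t^2 (1 - 2
    t) >= 1]. *)
Lemma invsqrt1B_le t : 0 <= t -> t <= 1 / 2 ->
  (Num.sqrt (1 - t))^-1 <= expR (t / 2 + t ^+ 2).
Proof.
move=> t0 t1; have tp : 0 < 1 - t by lra.
rewrite -[leRHS]ger0_norm ?expR_ge0// -sqrtr_sqr -sqrtrV ?(ltW tp)// ler_wsqrtr//.
rewrite -expRM_natl -[leLHS]mul1r ler_pdivrMr//.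
apply: le_trans (ler_wpM2r (ltW tp) (expR_ge1Dx _)); nra.
Qed.

(** The left side is the expectation of the combination dominating [exp (- Y^2 / 2)] when [Y] has
    variance [t]. Both sides are compared with [1 - t / 2 + 4 t^2]. *)
Lemma expR_second_order_le t : 0 <= t -> t <= 1 / 4 ->
  7 / 2 - 3 * expR (t / 2) + 1 / 2 * expR (2 * t) <= expR (- (t / 2) + 4 * t ^+ 2).
Proof.
move=> t0 t1.
have h1 := expR_ge1Dx (t / 2); have h2 := expR_ge1Dx (- (t / 2) + 4 * t ^+ 2).
have h3 : expR (2 * t) <= 1 + 2 * t + 2 * (2 * t) ^+ 2.
  have := expR_ge1Dx (- (2 * t)); have := expR_gt0 (2 * t).
  have := expRxMexpNx_1 (2 * t); nra.
lra.
Qed.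

End RealInequalities.

(** * Laplace transforms of a sum of squares of Gaussian coordinates *)

Section QuadraticForm.
Context {R : realType} d (Omega : measurableType d) (P : probability Omega R).
Context p (Y : 'I_p -> Omega -> R) (g : 'I_p -> R).
Hypothesis mY : forall r, measurable_fun setT (Y r).
Hypothesis g_ge0 : forall r, 0 <= g r.
Hypothesis mgfY : forall u : 'I_p -> R,
  (\int[P]_w (expR (\sum_r u r * Y r w))%:E = (expR (\sum_r g r * u r ^+ 2 / 2))%:E)%E.
Notation mu := (@lebesgue_measure R).

Lemma mgf_sqr_le (l : R) : 0 <= l -> (forall r, l * g r <= 1 / 2) ->
  (\int[P]_w (expR (l * (\sum_r Y r w ^+ 2) / 2))%:E <=
   (expR (\sum_r (l * g r / 2 + (l * g r) ^+ 2)))%:E)%E.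
Proof.
move=> l0 lg.
(* The coordinates r < m carry the square, the others a free linear tilt u; passing
   from m to m.+1 averages the tilt of coordinate m against a standard normal. *)
pose W (m : nat) (u : 'I_p -> R) w :=
  \sum_(r < p) (if (r < m)%N then l * Y r w ^+ 2 / 2 else u r * Y r w).
pose B (m : nat) (u : 'I_p -> R) := \sum_(r < p) (if (r < m)%N then l * g r / 2 + (l * g r) ^+ 2
   else g r * u r ^+ 2 / 2).
suff main m : (m <= p)%N -> forall u,
    (\int[P]_w (expR (W m u w))%:E <= (expR (B m u))%:E)%E.
  have := main p (leqnn p) (fun=> 0); rewrite /W /B.
  congr (_ <= (expR _)%:E)%E; last by apply: eq_bigr => r _; rewrite ltn_ord.
  apply: eq_integral => w _; congr (expR _)%:E.
  by rewrite mulr_sumr mulr_suml; apply: eq_bigr => r _; rewrite ltn_ord.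
have mW (r : 'I_p) (m' : nat) (u' : 'I_p -> R) : measurable_fun setT
    (fun w => if (r < m')%N then l * Y r w ^+ 2 / 2 else u' r * Y r w).
  case: (r < m')%N; apply: measurable_funM => //.
  by apply: measurable_funM => //; apply: measurable_funX.
elim: m => [_ u|m IH mp u].
  by rewrite [leLHS]mgfY.
pose k := Ordinal mp.
pose A w := \sum_(r < p | r != k) (if (r < m)%N then l * Y r w ^+ 2 / 2 else u r * Y r w).
pose C := \sum_(r < p | r != k) (if (r < m)%N then l * g r / 2 + (l * g r) ^+ 2
   else g r * u r ^+ 2 / 2).
pose upd (x : R) (r : 'I_p) := if r == k then Num.sqrt l * x else u r.
have lt_m (r : 'I_p) : r != k -> (r < m.+1)%N = (r < m)%N.
  by move=> rk; rewrite ltnS leq_eqVlt orb_idl// => /eqP rm; case/eqP: rk; apply: val_inj.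
have WS w : W m.+1 u w = A w + l * Y k w ^+ 2 / 2.
  rewrite /W (bigD1 k)//= ltnSn addrC; congr (_ + _).
  by apply: eq_bigr => r rk; rewrite lt_m.
have BS : B m.+1 u = C + (l * g k / 2 + (l * g k) ^+ 2).
  rewrite /B (bigD1 k)//= ltnSn addrC; congr (_ + _).
  by apply: eq_bigr => r rk; rewrite lt_m.
have Wu x w : W m (upd x) w = A w + Num.sqrt l * x * Y k w.
  rewrite /W (bigD1 k)//= ltnn {1}/upd eqxx addrC; congr (_ + _).
  by apply: eq_bigr => r rk; rewrite /upd (negbTE rk).
have Bu x : B m (upd x) = C + (l * g k) * x ^+ 2 / 2.
  rewrite /B (bigD1 k)//= ltnn {1}/upd eqxx addrC; congr (_ + _).
    by apply: eq_bigr => r rk; rewrite /upd (negbTE rk).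
  by rewrite exprMn sqr_sqrtr//; ring.
have mA : measurable_fun setT A.
  rewrite /A; under eq_fun do rewrite big_mkcond.
  by apply: measurable_sum => r; case: (r != k) => //; exact: mW.
pose f (z : Omega * measurableTypeR R) : \bar R :=
  ((expR (W m (upd z.2) z.1))%:E * (normal_pdf 0 1 z.2)%:E)%E.
have mf : measurable_fun setT f.
  apply: emeasurable_funM; apply/measurable_EFinP.
    apply: measurableT_comp => //; under eq_fun do rewrite Wu.
    apply: measurable_funD; first exact: measurableT_comp.
    apply: measurable_funM; last exact: measurableT_comp.
    by apply: measurable_funM.
  by apply: measurableT_comp => //; exact: measurable_normal_pdf.
have f0 z : (0 <= f z)%E by rewrite mule_ge0// lee_fin ?expR_ge0 ?normal_pdf_ge0.
have mpdf : measurable_fun setT (fun x : measurableTypeR R => (normal_pdf 0 1 x)%:E).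
  by apply/measurable_EFinP; exact: measurable_normal_pdf.
(* Writes [exp (l Y_k^2 / 2)] as the standard normal average over [x] of [exp (sqrt l x Y_k)]. *)
have -> : (\int[P]_w (expR (W m.+1 u w))%:E = \int[P]_w \int[mu]_x f (w, x))%E.
  apply: eq_integral => w _; rewrite WS expRD.
  under [RHS]eq_integral.
    move=> x _; rewrite /f /= Wu expRD EFinM -muleA; over.
  rewrite ge0_integralZl//; last 2 first.
  - apply: emeasurable_funM => //; apply/measurable_EFinP.
    by apply: measurableT_comp => //; do 2 apply: measurable_funM => //.
  - by move=> x _; rewrite mule_ge0// lee_fin ?expR_ge0 ?normal_pdf_ge0.
  rewrite EFinM; congr (_ * _)%E.
  under eq_integral do rewrite (mulrAC (Num.sqrt l)).
  rewrite integral_expR_normal_pdf ?oner_eq0//.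
  by rewrite exprMn sqr_sqrtr// expr1n mulr1.
rewrite fubini_tonelli//.
(* For each fixed [x], the induction hypothesis at the tilt [upd x] bounds the inner integral. *)
apply: (@le_trans _ _ (\int[mu]_x ((expR C)%:E *
    ((expR (l * g k * x ^+ 2 / 2))%:E * (normal_pdf 0 1 x)%:E)))%E).
  apply: ge0_le_integral => //.
  - by move=> x _; apply: integral_ge0.
  - exact: measurable_fun_fubini_tonelli_G.
  - apply: emeasurable_funM => //; apply: emeasurable_funM => //; apply/measurable_EFinP.
    apply: measurableT_comp => //; apply: measurable_funM => //.
    by apply: measurable_funM => //; apply: measurable_funX.
  - move=> x _; rewrite /f /=.
    rewrite ge0_integralZr//; last by rewrite lee_fin normal_pdf_ge0.
      rewrite muleA lee_wpmul2r ?lee_fin ?normal_pdf_ge0//.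
      by rewrite -EFinM -expRD -Bu; exact: IH (ltnW mp) _.
    apply/measurable_EFinP; apply: measurableT_comp => //.
    by apply: measurable_sum => r; exact: mW.
rewrite ge0_integralZl//; last 2 first.
- apply: emeasurable_funM => //; apply/measurable_EFinP.
  apply: measurableT_comp => //; apply: measurable_funM => //.
  by apply: measurable_funM => //; apply: measurable_funX.
- by move=> x _; rewrite mule_ge0// lee_fin ?expR_ge0 ?normal_pdf_ge0.
rewrite integral_expR_sqr_normal_pdf; last by apply: le_lt_trans (lg k) _; lra.
rewrite BS expRD EFinM lee_wpmul2l ?lee_fin ?expR_ge0//.
by apply: invsqrt1B_le; rewrite ?mulr_ge0.
Qed.

Lemma mgf_sqrN_le (l : R) : 0 <= l -> (forall r, l * g r <= 1 / 4) ->
  (\int[P]_w (expR (- (l * (\sum_r Y r w ^+ 2) / 2)))%:E <=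
   (expR (\sum_r (- (l * g r / 2) + 4 * (l * g r) ^+ 2)))%:E)%E.
Proof.
move=> l0 lg.
pose c (k : 'I_5) : R := nth 0 [:: 7 / 2; - (3 / 2); - (3 / 2); 1 / 4; 1 / 4] k.
pose a (k : 'I_5) : R := nth 0 [:: 0; 1; -1; 2; -2] k.
have mlin (u : 'I_p -> R) : measurable_fun setT (fun w => (expR (\sum_r u r * Y r w))%:E).
  apply/measurable_EFinP; apply: measurableT_comp => //.
  by apply: measurable_sum => r; exact: measurable_funM.
(* h = 1 - z + z ^ 2 with z = cosh - 1, expanded into exponentials *)
pose h x := \sum_k c k * expR (a k * x).
have hE x : h x = 7 / 2 - 3 / 2 * (expR x + expR (- x))
    + 1 / 4 * (expR (2 * x) + expR (- (2 * x))).
  by rewrite /h 5!big_ord_recl big_ord0 /c /a /= mul0r expR0 mulN1r (mulNr 2 x) !mul1r; field.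
(* Each choice [phi] of one term per coordinate yields the exponential of a linear form, to which
   [mgfY] applies. *)
have prodh w : \prod_r h (Num.sqrt l * Y r w) =
   \sum_(phi : {ffun 'I_p -> 'I_5}) (\prod_r c (phi r)) *
      expR (\sum_r (a (phi r) * Num.sqrt l) * Y r w).
  rewrite /h bigA_distr_bigA /=; apply: eq_bigr => phi _.
  rewrite big_split /= expR_sum; congr (_ * _).
  by apply: eq_bigr => r _; rewrite mulrA.
have mprod : measurable_fun setT (fun w => (\prod_r h (Num.sqrt l * Y r w))%:E).
  apply/measurable_EFinP; under eq_fun do rewrite prodh.
  apply: measurable_sum => phi; apply: measurable_funM => //.
  by apply/measurable_EFinP; exact: mlin.
have le_h w : expR (- (l * (\sum_r Y r w ^+ 2) / 2)) <= \prod_r h (Num.sqrt l * Y r w).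
  rewrite mulr_sumr mulr_suml -sumrN expR_sum; apply: ler_prod => r _.
  rewrite expR_ge0 hE; have := expRN_sqr_le (Num.sqrt l * Y r w).
  by rewrite exprMn sqr_sqrtr.
(* The weights [c] have both signs, so the sum is integrated by linearity for integrable
   functions. *)
have int_lin phi : P.-integrable setT
    (fun w => (expR (\sum_r (a (phi r) * Num.sqrt l) * Y r w))%:E).
  apply/integrableP; split => //.
  under eq_integral do rewrite gee0_abs ?lee_fin ?expR_ge0//.
  by rewrite mgfY ltry.
apply: (@le_trans _ _ (\int[P]_w (\prod_r h (Num.sqrt l * Y r w))%:E)%E).
  apply: ge0_le_integral => //.
  - apply/measurable_EFinP; apply: measurableT_comp => //; apply: measurable_funN.
    apply: measurable_funM => //; apply: measurable_funM => //.
    by apply: measurable_sum => r; apply: measurable_funX.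
  - by move=> w _; rewrite lee_fin.
under eq_integral do rewrite prodh -sumEFin.
rewrite integral_sum//; last first.
  move=> phi; under eq_fun do rewrite EFinM.
  exact: integrableZl.
under eq_bigr => phi _.
  under eq_integral do rewrite EFinM.
  rewrite integralZl// mgfY -EFinM.
  over.
rewrite sumEFin lee_fin.
(* The expectations of the terms also factor over coordinates, so the sum over [phi] folds back into
   a product. *)
have -> : \sum_(phi : {ffun 'I_p -> 'I_5}) (\prod_r c (phi r)) *
    expR (\sum_r g r * (a (phi r) * Num.sqrt l) ^+ 2 / 2) =
    \prod_r \sum_k c k * expR (g r * (a k * Num.sqrt l) ^+ 2 / 2).
  rewrite bigA_distr_bigA /=; apply: eq_bigr => phi _.
  by rewrite big_split /= expR_sum.
rewrite expR_sum.
have factE r : \sum_k c k * expR (g r * (a k * Num.sqrt l) ^+ 2 / 2) =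
    7 / 2 - 3 * expR (l * g r / 2) + 1 / 2 * expR (2 * (l * g r)).
  rewrite 5!big_ord_recl big_ord0 /c /a /= !exprMn sqr_sqrtr// expr0n /= !(mul0r, mulr0) expR0.
  rewrite sqrrN expr1n mul1r (_ : g r * l / 2 = l * g r / 2); last by ring.
  rewrite sqrrN (_ : g r * (2 ^+ 2 * l) / 2 = 2 * (l * g r)); last by field.
  by field.
apply: ler_prod => r _; rewrite factE; apply/andP; split; last first.
  by apply: expR_second_order_le => //; rewrite mulr_ge0.
have t0 : 0 <= l * g r by rewrite mulr_ge0.
set t := l * g r in t0 *.
(* Comparing products needs nonnegative factors. With [e = exp (t / 2)] the factor is
   [7 / 2 - 3 e + e^4 / 2], at least [e^2 - 3 e + 3 > 0]. *)
have -> : 2 * t = t / 2 + t / 2 + (t / 2 + t / 2) by field.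
rewrite !expRD; have := expR_ge1Dx (t / 2); set e := expR _ => e1.
have := sqr_ge0 (e * e - 1); have := sqr_ge0 (e - 3 / 2); rewrite !expr2; nra.
Qed.

End QuadraticForm.

(** * Chernoff bounds for linear and quadratic forms *)

Section Tail.
Context {R : realType} d (Omega : measurableType d) (P : probability Omega R).

Lemma measurable_gt (f : Omega -> R) (c : R) :
  measurable_fun setT f -> measurable [set w | c < f w].
Proof.
move=> mf; rewrite (_ : [set w | _] = setT `&` f @^-1` `]c, +oo[).
  by apply: mf => //; exact: measurable_itv.
by rewrite setTI; apply/seteqP; split => w; rewrite /= in_itv/= andbT.
Qed.

Lemma measurable_ge (f : Omega -> R) (c : R) :
  measurable_fun setT f -> measurable [set w | c <= f w].
Proof.
move=> mf; rewrite (_ : [set w | _] = setT `&` f @^-1` `[c, +oo[).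
  by apply: mf => //; exact: measurable_itv.
by rewrite setTI; apply/seteqP; split => w; rewrite /= in_itv/= andbT.
Qed.

(** Continuity from below along the levels [c + 1 / (m + 1)]. *)
Lemma probability_gt_le (f : Omega -> R) (c : R) (b : \bar R) :
  measurable_fun setT f ->
  (forall e : R, 0 < e -> (P [set w | (c + e < f w)%R] <= b)%E) ->
  (P [set w | (c < f w)%R] <= b)%E.
Proof.
move=> mf fb.
have mgt c' : measurable [set w | c' < f w] by exact: measurable_gt.
pose F m := [set w | c + m.+1%:R^-1 < f w].
have UF : [set w | c < f w] = \bigcup_m F m.
  apply/seteqP; split => w /=; last first.
    by move=> [m _]; apply: lt_trans; rewrite ltrDl invr_gt0.
  move=> cf; have [m] := ltr_add_invr cf; by exists m.
have ndF : nondecreasing_seq F.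
  move=> m n mn; apply/subsetPset => w; apply: le_lt_trans.
  by rewrite lerD2l lef_pV2 ?posrE// ler_nat ltnS.
have cvgF := nondecreasing_cvg_mu (mu := P) (fun m => mgt (c + m.+1%:R^-1))
  (bigcupT_measurable _ (fun m => mgt _)) ndF.
rewrite UF -(cvg_lim _ cvgF)//; apply: lime_le; first by apply/cvg_ex; eexists; exact: cvgF.
by apply: nearW => m; apply: fb; rewrite invr_gt0.
Qed.

(** Chernoff with [l] close to [sqrt L / (tau + sqrt L b)]: then [l * tau <= sqrt L], so the
    transform is at most [exp L], while [l] times the level is [3 L]. *)
Lemma bernstein (f : Omega -> R) (tau b L : R) : measurable_fun setT f ->
  0 <= tau -> 0 <= b -> 0 < L ->
  (forall l, 0 < l -> l * b <= 1 ->
     (\int[P]_w (expR (l * f w))%:E <= (expR (l ^+ 2 * tau ^+ 2))%:E)%E) ->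
  (P [set w | (3 * (Num.sqrt L * tau + L * b) < f w)%R] <= (expR (- (2 * L)))%:E)%E.
Proof.
move=> mf tau0 b0 L0 mgf.
(* The slack e keeps the denominator D of the exponent l positive when tau = b = 0. *)
apply: probability_gt_le => // e e0.
set q := Num.sqrt L; have q0 : 0 < q by rewrite sqrtr_gt0.
have qq : q ^+ 2 = L by rewrite sqr_sqrtr// ltW.
pose D := tau + q * b + e / (3 * q).
have eq0 : 0 < e / (3 * q) by rewrite divr_gt0// mulr_gt0.
have qb0 : 0 <= q * b by rewrite mulr_ge0// ltW.
have D0 : 0 < D by rewrite /D; lra.
pose l := q / D; have l0 : 0 < l by rewrite divr_gt0.
have lb : l * b <= 1 by rewrite /l mulrAC ler_pdivrMr// mul1r /D; lra.
have ltau : l * tau <= q.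
  by rewrite /l mulrAC ler_pdivrMr// ler_wpM2l ?(ltW q0)// /D; lra.
have cE : 3 * (q * tau + L * b) + e = 3 * q * D.
  by rewrite /D -qq; field; rewrite gt_eqF.
have lc : l * (3 * q * D) = 3 * L.
  by rewrite /l -qq; field; rewrite gt_eqF.
pose X : {mfun Omega >-> R} := HB.pack f (isMeasurableFun.Build _ _ _ _ f mf).
have mge := measurable_ge (3 * q * D) mf; have mgt := measurable_gt (3 * q * D) mf.
rewrite cE; apply: (@le_trans _ _ (P [set w | 3 * q * D <= f w])).
  by apply: le_measure; rewrite ?inE// => w /=; exact: ltW.
apply: le_trans (@chernoff _ _ _ P X l (3 * q * D) l0) _.
rewrite /mmt_gen_fun unlock lc.
apply: (@le_trans _ _ ((expR L)%:E * (expR (- (3 * L)))%:E)%E); last first.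
  by rewrite -EFinM -expRD lee_fin ler_expR; lra.
apply: lee_wpmul2r; first by rewrite lee_fin expR_ge0.
apply: (@le_trans _ _ (\int[P]_w (expR (l * f w))%:E)%E).
  by rewrite le_eqVlt; apply/orP; left; apply/eqP; apply: eq_integral => w _ /=; rewrite mulrC.
apply: le_trans (mgf l l0 lb) _; rewrite lee_fin ler_expR -exprMn -qq.
have x0 : 0 <= l * tau by rewrite mulr_ge0 ?(ltW l0).
by rewrite -subr_ge0 subr_sqr mulr_ge0 ?subr_ge0 ?addr_ge0 ?(ltW q0).
Qed.

Context p (X : Omega -> 'cV[R]_p) (G : 'M[R]_p).
Hypothesis mX : random_vec X.
Hypothesis symG : G^T = G.
Hypothesis G_ge0 : forall u, 0 <= vdot u (G *m u).
Hypothesis mgfX : forall u,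
  (\int[P]_w (expR (vdot u (X w)))%:E = (expR (vdot u (G *m u) / 2))%:E)%E.

(** The transform of [2 <a, X>] at [l] is [exp (2 l^2 <a, G a>)]: the Bernstein bound with
    [b = 0]. *)
Lemma linear_tail (a : 'cV[R]_p) (tau L : R) : 0 < L -> 0 <= tau ->
  2 * vdot a (G *m a) <= tau ^+ 2 ->
  (P [set w | (3 * (Num.sqrt L * tau) < 2 * vdot a (X w))%R] <= (expR (- (2 * L)))%:E)%E.
Proof.
move=> L0 tau0 atau.
have := @bernstein (fun w => 2 * vdot a (X w)) tau 0 L.
rewrite mulr0 addr0; apply => //.
  by apply: measurable_funM => //; exact: measurable_vdot.
move=> l l0 _; under eq_integral do rewrite mulrA -vdotZl.
rewrite mgfX lee_fin ler_expR -scalemxAr vdotZl vdotZr.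
have := ler_wpM2l (sqr_ge0 l) atau; lra.
Qed.

(** With parameter [2 l] in the bounds for squares, the linear part cancels [l tr G], leaving
    [4 l^2 tr G^2] above and [16 l^2 tr G^2] below; hence [4 T]. The [8 b] ensures
    [2 l g_r <= 1 / 4]. *)
Lemma quadratic_tail (T b L : R) : 0 < L -> 0 <= T -> 0 <= b ->
  \tr (G *m G) <= T ^+ 2 -> (forall v, vdot v (G *m v) <= b * sqnorm v) ->
  (P [set w | (3 * (Num.sqrt L * (4 * T) + L * (8 * b)) < sqnorm (X w) - \tr G)%R]
     <= (expR (- (2 * L)))%:E)%E /\
  (P [set w | (3 * (Num.sqrt L * (4 * T) + L * (8 * b)) < - (sqnorm (X w) - \tr G))%R]
     <= (expR (- (2 * L)))%:E)%E.
Proof.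
move=> L0 T0 b0 GT Gb.
have [U [D [UU UGU]]] := spectral symG.
have [trG trGG] := mxtrace_sqr UU UGU.
pose Y r w := (U^T *m X w) r 0; pose g r := D 0 r.
have YE (u : 'I_p -> R) w : \sum_r u r * Y r w = vdot (U *m \col_r u r) (X w).
  by rewrite vdot_mull; apply: eq_bigr => r _; rewrite [in RHS]mxE.
have mYu (u : 'I_p -> R) : measurable_fun setT (fun w => \sum_r u r * Y r w).
  by under eq_fun do rewrite YE; exact: measurable_vdot.
have Yd r w : Y r w = \sum_s (s == r)%:R * Y s w.
  rewrite (bigD1 r)//= eqxx mul1r big1 ?addr0// => s /negbTE->; exact: mul0r.
have mY r : measurable_fun setT (Y r).
  rewrite (_ : Y r = fun w => \sum_s (s == r)%:R * Y s w).
    exact: (mYu (fun s => (s == r)%:R)).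
  by apply/funext => w; rewrite -Yd.
have quadE (u : 'I_p -> R) : \sum_r g r * u r ^+ 2 =
    vdot (U *m \col_r u r) (G *m (U *m \col_r u r)).
  by rewrite (vdot_spectral _ UGU); apply: eq_bigr => r _; rewrite mxE.
have mgfY (u : 'I_p -> R) : (\int[P]_w (expR (\sum_r u r * Y r w))%:E =
    (expR (\sum_r g r * u r ^+ 2 / 2))%:E)%E.
  under eq_integral do rewrite YE.
  by rewrite mgfX -mulr_suml quadE.
(* The form at the [r]-th eigenvector gives [g r], hence its bounds 0 and [b]. *)
have gE r : g r = \sum_s g s * (s == r)%:R ^+ 2.
  rewrite (bigD1 r)//= eqxx expr1n mulr1 big1 ?addr0// => s /negbTE->.
  by rewrite expr0n mulr0.
have g0 r : 0 <= g r by rewrite gE (quadE (fun s => (s == r)%:R)).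
have gb r : g r <= b.
  rewrite gE (quadE (fun s => (s == r)%:R)); apply: le_trans (Gb _) _.
  rewrite sqnorm_orth// /sqnorm /vdot (bigD1 r)//= big1 => [|s /negbTE sr]; rewrite !mxE.
    by rewrite eqxx mulr1 addr0 mulr1.
  by rewrite sr mul0r.
have XY w : sqnorm (X w) = \sum_r Y r w ^+ 2.
  have UU' : U^T^T *m U^T = 1%:M by rewrite trmxK; exact: mulmx1C.
  by rewrite -(sqnorm_orth _ UU'); apply: eq_bigr => r _; rewrite expr2.
have mS : measurable_fun setT (fun w => sqnorm (X w) - \tr G).
  apply: measurable_funB => //; under eq_fun do rewrite XY.
  by apply: measurable_sum => r; exact: measurable_funX.
have lg l c r : 0 < l -> l * (8 * b) <= 1 -> 1 / 4 <= c -> 2 * l * g r <= c.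
  move=> l0 lb c4; have := ler_wpM2l (ltW l0) (gb r); lra.
have mexpX (l : R) : measurable_fun setT (fun w => (expR (l * (\sum_r Y r w ^+ 2) / 2))%:E).
  apply/measurable_EFinP; apply: measurableT_comp => //; apply: measurable_funM => //.
  by apply: measurable_funM => //; apply: measurable_sum => r; exact: measurable_funX.
have mexpXN (l : R) : measurable_fun setT (fun w => (expR (- (l * (\sum_r Y r w ^+ 2) / 2)))%:E).
  apply/measurable_EFinP; apply: measurableT_comp => //; apply: measurable_funN => //.
  apply: measurable_funM => //; apply: measurable_funM => //.
  by apply: measurable_sum => r; exact: measurable_funX.
split; apply: bernstein => //; rewrite ?mulr_ge0// => l l0 lb.
- have l20 : 0 <= 2 * l by lra.
  under eq_integral.
    move=> w _; rewrite (_ : l * _ = 2 * l * (\sum_r Y r w ^+ 2) / 2 + - (l * \tr G)); last first.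
      by rewrite XY; field.
    rewrite expRD EFinM; over.
  rewrite ge0_integralZr//.
  apply: le_trans (lee_wpmul2r _ (mgf_sqr_le mY g0 mgfY l20 _)) _ => [|r|].
  + by rewrite lee_fin expR_ge0.
  + by apply: lg => //; lra.
  rewrite -EFinM -expRD lee_fin ler_expR big_split /= -mulr_suml -mulr_sumr -trG.
  under eq_bigr do rewrite exprMn.
  rewrite -mulr_sumr -trGG.
  have := ler_wpM2l (sqr_ge0 l) GT; have := mulr_ge0 (sqr_ge0 l) (sqr_ge0 T); lra.
- exact: measurable_funN.
- have l20 : 0 <= 2 * l by lra.
  under eq_integral.
    move=> w _; rewrite (_ : l * _ = - (2 * l * (\sum_r Y r w ^+ 2) / 2) + l * \tr G); last first.
      by rewrite XY; field.
    rewrite expRD EFinM; over.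
  rewrite ge0_integralZr//.
  apply: le_trans (lee_wpmul2r _ (mgf_sqrN_le mY g0 mgfY l20 _)) _ => [|r|].
  + by rewrite lee_fin expR_ge0.
  + by apply: lg => //; lra.
  rewrite -EFinM -expRD lee_fin ler_expR big_split /= sumrN -mulr_suml -mulr_sumr -trG.
  under eq_bigr do rewrite exprMn.
  rewrite -!mulr_sumr -trGG.
  have := ler_wpM2l (sqr_ge0 l) GT; have := mulr_ge0 (sqr_ge0 l) (sqr_ge0 T); lra.
Qed.

End Tail.

(** * Deviation of a single triple, and the union bound *)

Section Deviation.
Context {R : realType} d (Omega : measurableType d) (P : probability Omega R).

Lemma measurable_sqnorm p (X : Omega -> 'cV[R]_p) :
  random_vec X -> measurable_fun setT (fun w => sqnorm (X w)).
Proof. by move=> mX; apply: measurable_sum => r; exact: measurable_funM. Qed.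

(** The deviation is [2 <a, X> + (|X|^2 - tr G)]; if it is large, one of four one-sided events
    occurs, each of probability at most [exp (- 2 L)]. *)
Lemma deviation_tail p (X : Omega -> 'cV[R]_p) (G : 'M[R]_p) (a : 'cV[R]_p)
    (tau T b L : R) : random_vec X -> G^T = G ->
  (forall u, 0 <= vdot u (G *m u)) ->
  (forall u, (\int[P]_w (expR (vdot u (X w)))%:E = (expR (vdot u (G *m u) / 2))%:E)%E) ->
  0 < L -> 0 <= T -> 0 <= b -> 0 <= tau ->
  \tr (G *m G) <= T ^+ 2 -> (forall v, vdot v (G *m v) <= b * sqnorm v) ->
  2 * vdot a (G *m a) <= tau ^+ 2 ->
  (P [set w | (3 * (Num.sqrt L * (4 * T + tau) + L * (8 * b)) <
       `|sqnorm (a + X w) - sqnorm a - \tr G|)%R] <= (4 * expR (- (2 * L)))%:E)%E.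
Proof.
move=> mX symG G0 mgf L0 T0 b0 tau0 GT Gb atau.
have mS := measurable_sqnorm mX.
have [up dn] := quadratic_tail mX symG G0 mgf L0 T0 b0 GT Gb.
have lp := linear_tail mX mgf L0 tau0 atau.
have ln : (P [set w | (3 * (Num.sqrt L * tau) < 2 * vdot (- a) (X w))%R] <=
    (expR (- (2 * L)))%:E)%E.
  by apply: (linear_tail mX mgf) => //; rewrite mulmxN vdotNl vdotNr opprK.
set A1 := [set w | _] in up; set A2 := [set w | _] in dn.
set A3 := [set w | _] in lp; set A4 := [set w | _] in ln.
have mW : measurable_fun setT (fun w => sqnorm (X w) - \tr G) by exact: measurable_funB.
have m1 : measurable A1 by exact: measurable_gt.
have m2 : measurable A2 by apply: measurable_gt; exact: measurable_funN.
have m3 : measurable A3.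
  by apply: measurable_gt; apply: measurable_funM => //; exact: measurable_vdot.
have m4 : measurable A4.
  by apply: measurable_gt; apply: measurable_funM => //; exact: measurable_vdot.
have maX : random_vec (fun w => a + X w).
  by move=> r; under eq_fun do rewrite mxE; exact: measurable_funD.
apply: (@le_trans _ _ (P (A1 `|` A2 `|` (A3 `|` A4)))).
  apply: le_measure; rewrite ?inE.
  - apply: measurable_gt; apply: measurableT_comp => //.
    by apply: measurable_funB => //; apply: measurable_funB => //; exact: measurable_sqnorm.
  - by do ?apply: measurableU.
  move=> w /=; rewrite /A1 /A2 /A3 /A4 /=.
  have -> : sqnorm (a + X w) - sqnorm a - \tr G = 2 * vdot a (X w) + (sqnorm (X w) - \tr G).
    by rewrite /sqnorm !(vdotDl, vdotDr) (vdotC (X w) a); ring.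
  rewrite vdotNl; set x := vdot a _; set y := sqnorm _ - _.
  have -> : 3 * (Num.sqrt L * (4 * T + tau) + L * (8 * b)) =
    3 * (Num.sqrt L * (4 * T) + L * (8 * b)) + 3 * (Num.sqrt L * tau) by ring.
  set c := 3 * (_ + _); set e := 3 * _.
  move=> h.
  case: (ltP c y) => [|h1]; first by left; left.
  case: (ltP c (- y)) => [|h2]; first by left; right.
  case: (ltP e (2 * x)) => [|h3]; first by right; left.
  case: (ltP e (2 * - x)) => [|h4]; first by right; right.
  by exfalso; move: h; rewrite ltNge ler_norml; apply/negP; rewrite negbK; lra.
have -> : 4 * expR (- (2 * L)) = expR (- (2 * L)) + expR (- (2 * L)) +
  (expR (- (2 * L)) + expR (- (2 * L))) by ring.
rewrite !EFinD.
apply: le_trans (measureU2 _ _ _) _; do ?apply: measurableU => //.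
apply: leeD; (apply: le_trans (measureU2 _ _ _) _ => //; exact: leeD).
Qed.

(** The linear form splits as [<u, N_i> + <- Q^T u, N_j>], and independence adds the two
    exponents. *)
Lemma difference_mgf n p (N : 'I_n -> Omega -> 'cV[R]_p) (Sig : 'I_n -> 'M[R]_p)
    (Q : 'M[R]_p) (i j : 'I_n) (u : 'cV[R]_p) :
  (forall i, gaussian_vec P (N i) (Sig i)) -> mutually_independent_vecs P N ->
  i != j ->
  (\int[P]_w (expR (vdot u (N i w - Q *m N j w)))%:E =
   (expR (vdot u ((Sig i + Q *m Sig j *m Q^T) *m u) / 2))%:E)%E.
Proof.
move=> gN indN ij.
have E w : vdot u (N i w - Q *m N j w) = vdot u (N i w) + vdot (- (Q^T *m u)) (N j w).
  by rewrite vdotDr vdotNr vdotNl vdot_mull trmxK.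
under eq_integral do rewrite E.
rewrite (indep_mgf _ _ (fun i => let: And4 h _ _ _ := gN i in h) indN ij).
rewrite !(gaussian_mgf _ (gN _)) -EFinM -expRD mulmxN vdotNl vdotNr opprK.
congr (expR _)%:E; rewrite mulmxDl vdotDr mulrDl; congr (_ + _ / 2).
by rewrite vdot_mull trmxK !mulmxA.
Qed.

(** Union bound along the list. Measurability is proved jointly so that the result can be iterated
    on nested maxima. *)
Lemma fmax_tail (A : eqType) (s : seq A) (f : A -> Omega -> R) (c B : R) (m : nat) :
  0 <= c -> 0 <= B -> (size s <= m)%N ->
  (forall x, x \in s -> measurable_fun setT (f x)) ->
  (forall x, x \in s -> (P [set w | (c < f x w)%R] <= B%:E)%E) ->
  measurable_fun setT (fun w => fmax [seq f x w | x <- s]) /\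
  (P [set w | (c < fmax [seq f x w | x <- s])%R] <= (m%:R * B)%:E)%E.
Proof.
move=> c0 B0 sm mf fB.
suff [mF FB] : measurable_fun setT (fun w => fmax [seq f x w | x <- s]) /\
  (P [set w | (c < fmax [seq f x w | x <- s])%R] <= ((size s)%:R * B)%:E)%E.
  split=> //; apply: le_trans FB _.
  by rewrite lee_fin ler_wpM2r// ler_nat.
elim: s {sm} mf fB => [|x s IH] mf fB.
  split.
    by rewrite /fmax; under eq_fun do rewrite big_nil; exact: measurable_cst.
  rewrite (_ : [set w | _] = set0) ?measure0 ?lee_fin ?mulr_ge0//.
  by apply/seteqP; split => w //=; rewrite lt_fmax.
have [||mF FB] := IH.
- by move=> y ys; apply: mf; rewrite inE ys orbT.
- by move=> y ys; apply: fB; rewrite inE ys orbT.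
have mfx := mf x (mem_head _ _); have fxB := fB x (mem_head _ _).
split.
  by rewrite /fmax; under eq_fun do rewrite /= big_cons; exact: measurable_maxr.
rewrite (_ : [set w | _] = [set w | c < f x w] `|` [set w | c < fmax [seq f x w | x <- s]]).
  apply: le_trans (measureU2 _ _ _) _; [exact: measurable_gt|exact: measurable_gt|].
  by rewrite /= -natr1 mulrDl mul1r addrC EFinD leeD.
by apply/seteqP; split => w /=; rewrite !lt_fmax //= => /orP.
Qed.

End Deviation.

(** * Uniform bound over all triples and conclusion *)

Lemma le_sqr_sqrtr (R : rcfType) (x y : R) : Num.sqrt x <= y -> x <= y ^+ 2.
Proof.
(* A negative [x] is trivially below a square, so traces and operator norms can be used without
   knowing their sign. *)
move=> xy; have [x0|x0] := leP 0 x; last by apply: le_trans (ltW x0) (sqr_ge0 _).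
have := sqrtr_ge0 x; have := sqr_sqrtr x0; nra.
Qed.

(** As [T] contains the identity, [t], [s] and [M] also control [Sig i] and [S i]. The single-triple
    bound applies with [2 t], [2 s^2] and [4 s M] for its [T], [b] and [tau]. *)
Lemma uniform_deviation_tail (R : realType) d (Omega : measurableType d)
    (P : probability Omega R) (n p : nat) (S : 'I_n -> 'cV[R]_p)
    (Sig : 'I_n -> 'M[R]_p) (N : 'I_n -> Omega -> 'cV[R]_p) (T : seq 'M[R]_p) :
  (forall i, gaussian_vec P (N i) (Sig i)) -> mutually_independent_vecs P N ->
  1%:M \in T -> (1 < n)%N ->
  let Iv i w := S i + N i w in
  let dev w :=
    fmax [seq fmax [seq fmax [seq
      `| sqnorm (Iv i w - Q *m Iv j w) - sqnorm (S i - Q *m S j)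
         - \tr (Sig i + Q *m Sig j *m Q^T) |
      | j <- enum 'I_n & j != i] | i <- enum 'I_n] | Q <- T] in
  let t := fmax [seq fmax [seq
      Num.sqrt (\tr ((Q *m Sig i *m Q^T) *m (Q *m Sig i *m Q^T)))
      | Q <- T] | i <- enum 'I_n] in
  let s := fmax [seq fmax [seq
      Num.sqrt (opnorm (Q *m Sig i *m Q^T))
      | Q <- T] | i <- enum 'I_n] in
  let M := fmax [seq fmax [seq enorm (Q *m S i)
      | Q <- T] | i <- enum 'I_n] in
  let L := ln ((size T)%:R * n%:R ^+ 2) in
  let rate := Num.sqrt L * (t + s * M) + L * s ^+ 2 in
  is_true (P [set w | (48 * rate < dev w)%R] <= (4 / n%:R)%:E)%E.
Proof.
move=> gN indN T1 n1 Iv dev t s M L rate.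
have le2 (F : 'M[R]_p -> 'I_n -> R) Q i : Q \in T ->
    F Q i <= fmax [seq fmax [seq F Q i | Q <- T] | i <- enum 'I_n].
  move=> QT; apply: (@le_trans _ _ (fmax [seq F Q i | Q <- T])).
    by apply: le_fmax; exact: (map_f (F^~ i)).
  by apply: le_fmax; apply/mapP; exists i; rewrite ?mem_enum.
have t0 : 0 <= t by exact: fmax_ge0.
have s0 : 0 <= s by exact: fmax_ge0.
have M0 : 0 <= M by exact: fmax_ge0.
have T0 : (0 < size T)%N by case: (T) T1.
(* This gives [L > 0] when [n > 1], and finally turns [4 exp (- L)] into [4 / n]. *)
have X4 : n%:R <= (size T)%:R * n%:R ^+ 2 :> R.
  rewrite -natrX -natrM ler_nat expnS expn1 mulnA leq_pmull// muln_gt0 T0.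
  exact: ltnW.
have n0 : 0 < n%:R :> R by rewrite ltr0n ltnW.
have X0 : 0 < (size T)%:R * n%:R ^+ 2 :> R by exact: lt_le_trans X4.
have L0 : 0 < L by rewrite ln_gt0// (lt_le_trans _ X4)// ltr1n.
have rate0 : 0 <= 48 * rate.
  by rewrite mulr_ge0// addr_ge0// mulr_ge0 ?sqrtr_ge0 ?addr_ge0 ?mulr_ge0 ?sqr_ge0// ltW.
have B0 : 0 <= 4 * expR (- (2 * L)) by rewrite mulr_ge0 ?expR_ge0.
have mN i : random_vec (N i) by have [] := gN i.
have symS i : (Sig i)^T = Sig i by have [] := gN i.
have S0 i u : 0 <= vdot u (Sig i *m u) by have [_ _ h _] := gN i; exact: h.
pose X (Q : 'M[R]_p) i j w := N i w - Q *m N j w.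
have mX Q i j : random_vec (X Q i j).
  move=> r; rewrite /X; under eq_fun do rewrite !mxE.
  apply: measurable_funB; first exact: mN.
  by apply: measurable_sum => k; apply: measurable_funM => //; exact: mN.
have IvE Q i j w : Iv i w - Q *m Iv j w = (S i - Q *m S j) + X Q i j w.
  by rewrite /Iv /X mulmxDr opprD addrACA.
have mdev Q i j : measurable_fun setT (fun w =>
    `| sqnorm (Iv i w - Q *m Iv j w) - sqnorm (S i - Q *m S j)
         - \tr (Sig i + Q *m Sig j *m Q^T) |).
  under eq_fun do rewrite IvE.
  apply: measurableT_comp => //; apply: measurable_funB => //; apply: measurable_funB => //.
  apply: measurable_sqnorm => r; under eq_fun do rewrite mxE.
  by apply: measurable_funD => //; exact: mX.
have dev1 Q i j : Q \in T -> j != i ->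
    (P [set w | (48 * rate < `| sqnorm (Iv i w - Q *m Iv j w) - sqnorm (S i - Q *m S j)
         - \tr (Sig i + Q *m Sig j *m Q^T) |)%R] <= (4 * expR (- (2 * L)))%:E)%E.
  move=> QT ji.
  have symB : (Q *m Sig j *m Q^T)^T = Q *m Sig j *m Q^T.
    by rewrite !trmx_mul trmxK symS mulmxA.
  have idE A : 1%:M *m A *m 1%:M^T = A :> 'M[R]_p by rewrite mul1mx trmx1 mulmx1.
  have trG : \tr ((Sig i + Q *m Sig j *m Q^T) *m (Sig i + Q *m Sig j *m Q^T)) <= (2 * t) ^+ 2.
    have ht := le2 (fun Q i => Num.sqrt (\tr ((Q *m Sig i *m Q^T) *m (Q *m Sig i *m Q^T)))).
    have := le_sqr_sqrtr (ht 1%:M i T1); have := le_sqr_sqrtr (ht Q j QT).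
    rewrite idE -/t => hQ hi; have := mxtrace_sqrD_le (symS i) symB; lra.
  have opG v : vdot v ((Sig i + Q *m Sig j *m Q^T) *m v) <= 2 * s ^+ 2 * sqnorm v.
    have hs := le2 (fun Q i => Num.sqrt (opnorm (Q *m Sig i *m Q^T))).
    have := le_sqr_sqrtr (hs 1%:M i T1); have := le_sqr_sqrtr (hs Q j QT).
    rewrite idE -/s => hQ hi; rewrite mulmxDl vdotDr.
    have := vdot_le_opnorm (Sig i) v; have := vdot_le_opnorm (Q *m Sig j *m Q^T) v.
    have := ler_wpM2r (sqnorm_ge0 v) hQ; have := ler_wpM2r (sqnorm_ge0 v) hi; lra.
  have aM : sqnorm (S i - Q *m S j) <= 4 * M ^+ 2.
    have hM := le2 (fun Q i => enorm (Q *m S i)).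
    have := le_sqr_sqrtr (hM 1%:M i T1); have := le_sqr_sqrtr (hM Q j QT).
    rewrite mul1mx -/M => hQ hi; have := sqnormB_le (S i) (Q *m S j); lra.
  have atau : 2 * vdot (S i - Q *m S j)
      ((Sig i + Q *m Sig j *m Q^T) *m (S i - Q *m S j)) <= (4 * s * M) ^+ 2.
    have := opG (S i - Q *m S j); have := ler_wpM2l (sqr_ge0 s) aM; lra.
  have G0 u : 0 <= vdot u ((Sig i + Q *m Sig j *m Q^T) *m u).
    by rewrite mulmxDl vdotDr addr_ge0// -!mulmxA -(trmxK Q) -vdot_mull trmxK.
  have ij : i != j by rewrite eq_sym.
  have mgf u := difference_mgf Q u gN indN ij.
  have symG : (Sig i + Q *m Sig j *m Q^T)^T = Sig i + Q *m Sig j *m Q^T.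
    by rewrite linearD /= symS symB.
  have := deviation_tail (mX Q i j) symG G0 mgf L0 _ _ _ trG opG atau.
  rewrite !mulr_ge0 ?sqr_ge0// => /(_ isT isT isT); apply: le_trans.
  apply: le_measure; rewrite ?inE.
  - exact: measurable_gt.
  - by under eq_set do rewrite -IvE; exact: measurable_gt.
  (* The level is [24 sqrt L t + 12 sqrt L s M + 48 L s^2], hence the constant 48. *)
  move=> w /=; rewrite IvE; apply: le_lt_trans.
  have := mulr_ge0 (sqrtr_ge0 L) t0; have := mulr_ge0 (sqrtr_ge0 L) (mulr_ge0 s0 M0).
  rewrite /rate; lra.
have szn i : (size [seq j <- enum 'I_n | j != i] <= n)%N.
  by rewrite size_filter; apply: leq_trans (count_size _ _) _; rewrite size_enum_ord.
have nB0 : 0 <= n%:R * (4 * expR (- (2 * L))) by rewrite mulr_ge0.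
(* The three nested maxima, over [j], [i] and [Q], multiply the bound by [n], [n] and [size T]. *)
have level1 Q i (QT : Q \in T) := fmax_tail (P := P) rate0 B0 (szn i)
  (fun j _ => mdev Q i j) (fun j => ltac:(rewrite mem_filter => /andP[ji _]; exact: dev1 QT ji)).
have szI : (size (enum 'I_n) <= n)%N by rewrite size_enum_ord.
have level2 Q (QT : Q \in T) := fmax_tail (P := P) rate0 nB0 szI
  (fun i _ => (level1 Q i QT).1) (fun i _ => (level1 Q i QT).2).
have nnB0 : 0 <= n%:R * (n%:R * (4 * expR (- (2 * L)))) by rewrite mulr_ge0.
have [_ bound] := fmax_tail (P := P) rate0 nnB0 (leqnn (size T))
  (fun Q QT => (level2 Q QT).1) (fun Q QT => (level2 Q QT).2).
apply: le_trans bound _; rewrite lee_fin.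
have -> : expR (- (2 * L)) = (((size T)%:R * n%:R ^+ 2) ^+ 2)^-1.
  by rewrite expRN expRM_natl lnK// posrE.
have T0R : 0 < (size T)%:R :> R by rewrite ltr0n.
have -> : (size T)%:R * (n%:R * (n%:R * (4 / ((size T)%:R * n%:R ^+ 2) ^+ 2))) =
    4 / ((size T)%:R * n%:R ^+ 2) :> R.
  by field; rewrite !gt_eqF.
by rewrite ler_pM2l// lef_pV2// posrE.
Qed.

Theorem theorem2p1 (R : realType)
  (d : nat -> measure_display) (Omega : forall k, measurableType (d k))
  (P : forall k, probability (Omega k) R)
  (n p : nat -> nat)
  (S : forall k, 'I_(n k) -> 'cV[R]_(p k))
  (Sig : forall k, 'I_(n k) -> 'M[R]_(p k))
  (N : forall k, 'I_(n k) -> Omega k -> 'cV[R]_(p k))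
  (T : forall k, seq 'M[R]_(p k)) :
  (forall m, \forall k \near \oo, (m <= n k)%N) ->
  (forall m, \forall k \near \oo, (m <= p k)%N) ->
  (forall k i, gaussian_vec (P k) (N k i) (Sig k i)) ->
  (forall k, mutually_independent_vecs (P k) (N k)) ->
  (forall k, uniq (T k)) ->
  (forall k, 1%:M \in T k) ->
  let Iv k i w := S k i + N k i w in
  let dev k w :=
    fmax [seq fmax [seq fmax [seq
      `| sqnorm (Iv k i w - Q *m Iv k j w) - sqnorm (S k i - Q *m S k j)
         - \tr (Sig k i + Q *m Sig k j *m Q^T) |
      | j <- enum 'I_(n k) & j != i] | i <- enum 'I_(n k)] | Q <- T k] in
  let t k := fmax [seq fmax [seq
      Num.sqrt (\tr ((Q *m Sig k i *m Q^T) *m (Q *m Sig k i *m Q^T)))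
      | Q <- T k] | i <- enum 'I_(n k)] in
  let s k := fmax [seq fmax [seq
      Num.sqrt (opnorm (Q *m Sig k i *m Q^T))
      | Q <- T k] | i <- enum 'I_(n k)] in
  let M k := fmax [seq fmax [seq enorm (Q *m S k i)
      | Q <- T k] | i <- enum 'I_(n k)] in
  let L k := ln ((size (T k))%:R * (n k)%:R ^+ 2) in
  let rate k := Num.sqrt (L k) * (t k + s k * M k) + L k * s k ^+ 2 in
  forall delta : R, 0 < delta ->
    exists K : R, \forall k \near \oo,
      (P k [set w | (K * rate k < dev k w)%R] < delta%:E)%E.
Proof.
move=> n_oo _ gN indN _ T1 Iv dev t s M L rate delta delta0.
(* The same constant serves every [delta], because the tail [4 / n] tends to 0; it suffices that
   [n >= 2] and [n > 4 / delta]. *)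
exists 48; have := n_oo (maxn 2 (Num.bound (4 / delta))).
apply: filterS => k; rewrite geq_max => /andP[n2 nb].
apply: le_lt_trans (uniform_deviation_tail (S k) (gN k) (indN k) (T1 k) n2) _.
have n0 : 0 < (n k)%:R :> R by rewrite ltr0n ltnW.
rewrite lte_fin ltr_pdivrMr// mulrC -ltr_pdivrMr//.
apply: lt_le_trans (archi_boundP _) _; first by rewrite divr_ge0// ltW.
by rewrite ler_nat.
Qed.
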